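(* Assume that (i) all non-slack nodes are injection nodes; (ii) gas flows only in the positive direction through each edge according to its orientation in the network graph, i.e. $\varphi_k(t)>0$ for every $k\in\mathcal E$; (iii) pressure is positive at each node; and (iv) the density-ratio condition stated in the context is satisfied. Suppose that the nodal concentration vector $\eta^{(2)}$ (hence $\eta^{(1)}=1-\eta^{(2)}$) is constant and that there exist two state solutions $p_1,p_2$ on $[0,T]$ of the isolated total pressure system (defined in the context), with respective initial conditions $\pi_1,\pi_2$, slack node pressures $(p_s)_1,(p_s)_2$, and non-slack injection flows $q_1,q_2$, for a given fixed set of control inputs $\{\underline\mu,\overline\mu\}$. (Here the subscripts $1,2$ label the two solutions, not the nodes.) If $\pi_1\le\pi_2$, $(p_s)_1(t)\le(p_s)_2(t)$, and $q_1(t)\ge q_2(t)$ componentwise for all $t\in[0,T]$, then $p_1(t)\le p_2(t)$ componentwise for all $t\in[0,T]$. Consequently, $\rho_1(t)\le\rho_2(t)$, where $\rho_1$ and $\rho_2$ are the total nodal densities of the two solutions, i.e. $\rho_j=p_j/c_j^2$ at each node $j\in\mathcal V_d$.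
   Context: Network. A connected directed graph has a finite edge set $\mathcal E$ and a finite node set $\mathcal V=\mathcal V_s\sqcup\mathcal V_d$ (slack and non-slack nodes). $k:i\mapsto j$ means edge $k$ is directed from node $i$ to node $j$. Every edge ends at a non-slack node, and every non-slack node has at least one incoming edge. Each edge $k$ has constants $\ell_k,D_k,\lambda_k>0$ (length, diameter, friction factor), and $\chi_k=\pi D_k^2/4$, $\Lambda_k=\sqrt{2D_k/(\lambda_k\ell_k)}$. The control inputs are piecewise-continuous functions $\underline\mu_k(t)\ge1$ (compression at the edge inlet) and $\overline\mu_k(t)\ge1$ (regulation at the edge outlet), $k\in\mathcal E$. Gas mixture. There are two gases $m=1,2$ with wave speeds $\sigma_1,\sigma_2>0$. Concentrations (mass fractions) of the two gases lie in $[0,1]$ and sum to $1$: $\alpha_i^{(m)}$ is prescribed at slack nodes $i\in\mathcal V_s$, $\beta_j^{(m)}$ is the prescribed concentration of the gas injected at node $j$, and $\eta_j^{(m)}$ is the concentration at the non-slack node $j\in\mathcal V_d$, assumed constant. Put $a_i^2=\sigma_1^2\alpha_i^{(1)}+\sigma_2^2\alpha_i^{(2)}$, $b_j^2=\sigma_1^2\beta_j^{(1)}+\sigma_2^2\beta_j^{(2)}$, $c_j^2=\sigma_1^2\eta_j^{(1)}+\sigma_2^2\eta_j^{(2)}$, with $a_i,b_j,c_j>0$. The network, the edge parameters, the control inputs and the concentrations $\alpha,\beta,\eta$ are the same for both solutions. Isolated total pressure system (all non-slack nodes being injection nodes). The state is the vector of pressures $p_j(t)$, $j\in\mathcal V_d$;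 the input parameters are the slack pressures $(p_s)_i(t)$, $i\in\mathcal V_s$, and the flow vector $d(t)=-q(t)$, where $q_j(t)\ge0$, $j\in\mathcal V_d$, is the mass inflow at node $j$ (piecewise continuous in $t$). Write $p_i=(p_s)_i$ and $\theta_i^2=a_i^2$ for $i\in\mathcal V_s$, and $\theta_i^2=c_i^2$ for $i\in\mathcal V_d$. For an edge $k:i\mapsto j$ define the mass flux $$\varphi_k=\operatorname{sign}(\underline\mu_kp_i-\overline\mu_kp_j)\,\Lambda_k\left|\frac{\overline\mu_kp_j}{c_j^2}\,(\underline\mu_kp_i-\overline\mu_kp_j)\right|^{1/2}.$$ The system is, for each $j\in\mathcal V_d$, $$r_j\dot p_j=\sum_{k:i\mapsto j}\theta_i^2\chi_k\varphi_k-\sum_{k:j\mapsto i}c_j^2\chi_k\varphi_k+b_j^2q_j,\qquad r_j=\sum_{k:i\mapsto j}\chi_k\ell_k\overline\mu_k>0 .$$ Density-ratio condition. Partial densities at nodes are $\rho_j^{(m)}=\eta_j^{(m)}p_j/c_j^2$ for $j\in\mathcal V_d$ and $s_i^{(m)}=\alpha_i^{(m)}(p_s)_i/a_i^2$ for $i\in\mathcal V_s$. For an edge $k:i\mapsto j$, the inlet and outlet partial densities are $\underline\rho_k^{(m)}=\underline\mu_ks_i^{(m)}$ if $i\in\mathcal V_s$, $\underline\rho_k^{(m)}=\underline\mu_k\rho_i^{(m)}$ if $i\in\mathcal V_d$, and $\overline\rho_k^{(m)}=\overline\mu_k\rho_j^{(m)}$. The condition is that, for some $\epsilon\le1$, for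 all $k\in\mathcal E$ and $m=1,2$, $$\frac{|\overline\rho_k^{(m)}-\underline\rho_k^{(m)}|}{\underline\rho_k^{(m)}}<\epsilon,\qquad \frac{|\overline\rho_k^{(m)}-\underline\rho_k^{(m)}|}{\overline\rho_k^{(m)}}<\epsilon .$$
   Formalization: The condition q_1(t) ≥ q_2(t) is read for the flow vectors d = -q (withdrawals), i.e. the mass inflows satisfy q_1(t) ≤ q_2(t); with q as inflow the stated direction is false, since more injection raises the pressure. *)

(* Defs.v *)
From HB Require Import structures.
From mathcomp Require Import all_boot all_order all_algebra.
From mathcomp Require Import all_classical all_reals all_analysis.

Set Implicit Arguments.
Unset Strict Implicit.
Unset Printing Implicit Defensive.

Import Order.TTheory GRing.Theory Num.Theory.
Import numFieldNormedType.Exports.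
Local Open Scope classical_set_scope.
Local Open Scope ring_scope.

(** A node of the network is [inl i] for a slack node [i : Vs] or [inr j] for
    a non-slack node [j : Vd].  Every edge ends at a non-slack node, hence the
    type of [dst].  Edges are a separate finite type, so that parallel edges
    are allowed. *)
Record network (R : realType) (Vs Vd E : finType) := Network {
  src : E -> Vs + Vd;
  dst : E -> Vd;
  len : E -> R;
  diam : E -> R;
  fric : E -> R
}.

Section Network.
Context {R : realType} {Vs Vd E : finType}.
Implicit Types (N : network R Vs Vd E) (k : E) (u v : Vs + Vd).

Definition adjacent N : rel (Vs + Vd) := fun u v =>
  [exists k, ((src N k == u) && (inr (dst N k) == v))
             || ((src N k == v) && (inr (dst N k) == u))].

Definition chi N k : R := pi * diam N k ^+ 2 / 4.

Definition Lambda N k : R := Num.sqrt (2 * diam N k / (fric N k * len N k)).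

(** Connectedness is that of the underlying undirected graph. *)
Definition valid_network N : Prop :=
  [/\ forall u v, connect (adjacent N) u v,
      forall j : Vd, exists k, dst N k = j &
      forall k, [/\ 0 < len N k, 0 < diam N k & 0 < fric N k]].

End Network.

(** The two gases are indexed by ['I_2]. *)
Record mixture (R : realType) (Vs Vd : finType) := Mixture {
  sigma : 'I_2 -> R;        (* wave speeds *)
  alpha : Vs -> 'I_2 -> R;  (* mass fractions at the slack nodes *)
  beta : Vd -> 'I_2 -> R;   (* mass fractions of the injected gas *)
  eta : Vd -> 'I_2 -> R     (* mass fractions at the non-slack nodes *)
}.

Section Mixture.
Context {R : realType} {Vs Vd : finType}.
Implicit Type M : mixture R Vs Vd.

Definition concentration (x : 'I_2 -> R) : Prop :=
  (forall m, 0 <= x m <= 1) /\ \sum_(m < 2) x m = 1.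

Definition valid_mixture M : Prop :=
  [/\ forall m, 0 < sigma M m,
      forall i, concentration (alpha M i),
      forall j, concentration (beta M j) &
      forall j, concentration (eta M j)].

(** [a_sq], [b_sq], [c_sq] are the squares of the mixture wave speeds [a],
    [b], [c], which only occur through their squares.  They are positive for a
    valid mixture, so that [a], [b], [c] are their positive square roots. *)
Definition a_sq M (i : Vs) : R := \sum_(m < 2) sigma M m ^+ 2 * alpha M i m.
Definition b_sq M (j : Vd) : R := \sum_(m < 2) sigma M m ^+ 2 * beta M j m.
Definition c_sq M (j : Vd) : R := \sum_(m < 2) sigma M m ^+ 2 * eta M j m.

Definition theta_sq M (v : Vs + Vd) : R :=
  match v with inl i => a_sq M i | inr j => c_sq M j end.

End Mixture.

(** The quantities below are taken at a fixed time: [mi] and [mo] are the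
    compression (edge inlet) and regulation (edge outlet) ratios, [ps] the
    slack pressures, [p] the non-slack pressures and [q] the mass inflows. *)
Section Instantaneous.
Context {R : realType} {Vs Vd E : finType}.
Variables (N : network R Vs Vd E) (M : mixture R Vs Vd).
Implicit Types (mi mo : E -> R) (ps : Vs -> R) (p q : Vd -> R).

Definition node_pressure ps p (v : Vs + Vd) : R :=
  match v with inl i => ps i | inr j => p j end.

Definition flux mi mo ps p (k : E) : R :=
  let pin := mi k * node_pressure ps p (src N k) in
  let pout := mo k * p (dst N k) in
  Num.sg (pin - pout) * Lambda N k
    * Num.sqrt `| pout / c_sq M (dst N k) * (pin - pout) |.

Definition inertia mo (j : Vd) : R :=
  \sum_(k | dst N k == j) chi N k * len N k * mo k.

Definition pressure_rhs mi mo ps q p (j : Vd) : R :=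
  \sum_(k | dst N k == j) theta_sq M (src N k) * chi N k * flux mi mo ps p k
  - \sum_(k | src N k == inr j) c_sq M j * chi N k * flux mi mo ps p k
  + b_sq M j * q j.

Definition partial_density ps p (v : Vs + Vd) (m : 'I_2) : R :=
  match v with
  | inl i => alpha M i m * ps i / a_sq M i
  | inr j => eta M j m * p j / c_sq M j
  end.

Definition inlet_density mi ps p (k : E) (m : 'I_2) : R :=
  mi k * partial_density ps p (src N k) m.

Definition outlet_density mo ps p (k : E) (m : 'I_2) : R :=
  mo k * partial_density ps p (inr (dst N k)) m.

(** A gas which is absent at both ends of an edge satisfies the inequalities
    below, because [0 / 0 = 0]. *)
Definition density_ratio_condition (eps : R) mi mo ps p : Prop :=
  forall k m,
    let rin := inlet_density mi ps p k m in
    let rout := outlet_density mo ps p k m in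
    `|rout - rin| / rin < eps /\ `|rout - rin| / rout < eps.

Definition total_density p (j : Vd) : R := p j / c_sq M j.

End Instantaneous.

(** Finitely many jumps on [[0, T]], with finite one-sided limits.  The value
    at a jump is by convention the limit from the right; without such a
    convention a pointwise condition at a jump time would say nothing about
    the values just after the jump. *)
Definition piecewise_continuous (R : realType) (T : R) (f : R -> R) : Prop :=
  [/\ forall t, 0 <= t < T -> f x @[x --> t^'+] --> f t,
      forall t, 0 < t <= T -> cvg (f x @[x --> t^'-]) &
      exists jumps : seq R,
        forall t, 0 < t < T -> t \notin jumps -> {for t, continuous f}].

Section Trajectories.
Context {R : realType} {Vs Vd E : finType}.
Variables (N : network R Vs Vd E) (M : mixture R Vs Vd) (T : R).
Implicit Types (mi mo : R -> E -> R) (ps : R -> Vs -> R) (q p : R -> Vd -> R).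

Definition admissible_control (mu : R -> E -> R) : Prop :=
  forall k, piecewise_continuous T (fun t => mu t k) /\
            (forall t, 0 <= t <= T -> 1 <= mu t k).

Definition admissible_injection q : Prop :=
  forall j, piecewise_continuous T (fun t => q t j) /\
            (forall t, 0 <= t <= T -> 0 <= q t j).

(** The flow vector [d = - q] is the withdrawal from the network.  The
    pressures are antitone in [d], that is monotone in the inflow [q], which
    enters [pressure_rhs] with a positive coefficient. *)
Definition flow_vector q : R -> Vd -> R := fun t j => - q t j.

(** As the inputs may jump, the differential equations are required only
    outside a finite set of times. *)
Definition pressure_solution mi mo ps q (p0 : Vd -> R) p : Prop :=
  [/\ forall j, p 0 j = p0 j,
      forall j, {within `[0, T], continuous (fun t => p t j)} &
      exists exceptions : seq R, forall t, 0 < t < T -> t \notin exceptions ->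
        forall j, derivable (fun s => p s j) t 1 /\
          inertia N (mo t) j * derive1 (fun s => p s j) t
          = pressure_rhs N M (mi t) (mo t) (ps t) (q t) (p t) j].

Definition positive_flow mi mo ps p : Prop :=
  forall t, 0 <= t <= T -> forall k, 0 < flux N M (mi t) (mo t) (ps t) (p t) k.

Definition positive_pressure ps p : Prop :=
  forall t, 0 <= t <= T -> forall v, 0 < node_pressure (ps t) (p t) v.

Definition density_ratio_on (eps : R) mi mo ps p : Prop :=
  forall t, 0 <= t <= T ->
    density_ratio_condition N M eps (mi t) (mo t) (ps t) (p t).

End Trajectories.

(* Main.v *)
(** The edge flux is homogeneous of degree one in the pressures, increasing in
    the inlet pressure, and decreasing in the outlet pressure as long as the
    inlet pressure is at most twice the outlet pressure; the density-ratio
    condition provides this by summing over the two gases with the weights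
    [sigma m ^+ 2].  Let [c] be the maximum over [j] of the ratios
    [p1 j / p2 j].  When [1 < c], comparing [p1] with [c p2] at a node
    where the maximum is attained shows that the derivative of the ratio there
    is nonpositive.  Hence [c] cannot rise above [1].  Working with ratios
    rather than differences makes a Lipschitz bound unnecessary; the fluxes may
    come arbitrarily close to [0], where the square root has none. *)

Require Import Defs.
From HB Require Import structures.
From mathcomp Require Import all_boot all_order all_algebra.
From mathcomp Require Import all_classical all_reals all_analysis.
From mathcomp Require Import ring lra.

Set Implicit Arguments.
Unset Strict Implicit.
Unset Printing Implicit Defensive.

Import Order.TTheory GRing.Theory Num.Theory.
Import numFieldNormedType.Exports.
Local Open Scope classical_set_scope.
Local Open Scope ring_scope.

(** * A maximum principle for finite families of real functions *)

Section RealAnalysis.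
Context {R : realType}.

Lemma within_itv_le_right (a b L : R) (f : R -> R) : a < b ->
  {within `[a, b], continuous f} ->
  (forall t, a < t < b -> f t <= L) -> f b <= L.
Proof.
move=> ab /(continuous_within_itvP _ ab)[_ _ fb] fL.
apply: (cvgr_to_le fb); near=> t; apply: fL; apply/andP; split; near: t.
- exact: nbhs_left_gt.
- exact: nbhs_left_lt.
Unshelve. all: by end_near. Qed.

(** If the bound failed inside the interval, [(h j t - L) * (b - t)] would have a positive maximum
    over all [j] and [t]. There the product rule gives a derivative [(h j t - L) / (b - t) > 0] for
    [h j], although [h j] is the largest of the family at that time. *)
Lemma max_le_of_derive1_le0 (I : finType) (h : I -> R -> R) (a b L : R) :
  a < b ->
  (forall j, {within `[a, b], continuous (h j)}) ->
  (forall j t, a < t < b -> derivable (h j) t 1) ->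
  (forall j t, a < t < b -> L < h j t -> (forall i, h i t <= h j t) ->
    derive1 (h j) t <= 0) ->
  (forall j, h j a <= L) ->
  forall j t, a <= t <= b -> h j t <= L.
Proof.
move=> ab hc hd hmax ha.
suff main : forall j t, a < t < b -> h j t <= L.
  move=> j t /andP[]; rewrite le_eqVlt => /predU1P[<- _//|at_].
  rewrite le_eqVlt => /predU1P[->|tb]; last by apply: main; rewrite at_ tb.
  exact: (within_itv_le_right ab (hc j) (main j)).
move=> j0 t0 /andP[at0 t0b]; rewrite leNgt; apply/negP => Lh0.
(* The factor [b - t] keeps the maximum away from [b], where no derivative is
   available. *)
pose g j t := (h j t - L) * (b - t).
have gc j : {within `[a, b], continuous (g j)}.
  move=> x; apply: cvgM; apply: cvgB; [exact: hc|exact: cvg_cst|exact: cvg_cst|].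
  exact: (@continuous_subspaceT _ _ _ (@id R) (fun y => @cvg_id _ (nbhs y))).
have /choice[c cP] : forall j, exists x, x \in `[a, b] /\
    forall t, t \in `[a, b] -> g j t <= g j x.
  by move=> j; have [x xab xm] := EVT_max (ltW ab) (gc j); exists x.
have [j _ jmax] := @arg_maxP _ _ _ j0 xpredT (fun j => g j (c j)) isT.
have gmax i t : a <= t <= b -> g i t <= g j (c j).
  move=> tab; apply: le_trans (jmax i isT).
  by apply: (cP i).2; rewrite in_itv.
have g0 : 0 < g j (c j).
  apply: (@lt_le_trans _ _ (g j0 t0)); first by rewrite mulr_gt0 ?subr_gt0.
  by apply: gmax; rewrite !ltW.
(* A positive value excludes both ends: at [b] the factor [b - t] vanishes, at [a] the initial bound
   applies. *)
have cab : a < c j < b.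
  have := (cP j).1; rewrite in_itv/= !le_eqVlt => /andP[].
  move=> /predU1P[ca|->]; last first.
    move=> /predU1P[cb|->//].
    by rewrite /g cb subrr mulr0 ltxx in g0.
  move: g0; rewrite -ca /g pmulr_lgt0 ?subr_gt0 // => hL _.
  by have := ha j; rewrite leNgt hL.
have bc : 0 < b - c j by case/andP: cab; rewrite subr_gt0.
have hLj : L < h j (c j) by move: g0; rewrite /g pmulr_lgt0 // subr_gt0.
have hj0 : derive1 (h j) (c j) <= 0.
  (* At a fixed time all the [g i] share the positive factor [b - c j], so the order of the [g i] is
     that of the [h i]. *)
  apply: hmax => // i; have := gmax i (c j).
  by rewrite /g ler_pM2r // lerD2r; apply; rewrite !ltW //; case/andP: cab.
have gd t : a < t < b ->
    is_derive t 1 (g j) ((h j t - L) * (0 - 1) + (b - t) * ('D_1 (h j) t - 0)).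
  move=> tab; have Dh : is_derive t 1 (h j) ('D_1 (h j) t).
    by apply: DeriveDef => //; exact: hd.
  exact: (@is_deriveM _ _ (fun t => h j t - L) (fun t => b - t)).
have [_ Dg0] : is_derive (c j) 1 (g j) 0.
  apply: (derive1_at_max (ltW ab)); rewrite ?in_itv//= => t; rewrite in_itv/=.
    by move=> tab; case: (gd t tab).
  by case/andP=> ? ?; apply: gmax; rewrite !ltW.
have [_] := gd _ cab; rewrite Dg0 -derive1E => /esym.
nra.
Qed.

(** Cutting the interval at an exceptional time turns that time into an endpoint, where nothing is
    asked of the derivative. The bound reached at the cut is the initial bound of the right-hand
    piece. *)
Lemma max_le_of_derive1_le0_except (I : finType) (h : I -> R -> R) (L : R)
    (s : seq R) (a b : R) :
  a < b ->
  (forall j, {within `[a, b], continuous (h j)}) ->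
  (forall j t, a < t < b -> t \notin s -> derivable (h j) t 1) ->
  (forall j t, a < t < b -> t \notin s -> L < h j t ->
    (forall i, h i t <= h j t) -> derive1 (h j) t <= 0) ->
  (forall j, h j a <= L) ->
  forall j t, a <= t <= b -> h j t <= L.
Proof.
elim: s a b => [|x s IH] a b ab hc hd hmax ha.
  by apply: max_le_of_derive1_le0 => // j t tab; [exact: hd|exact: hmax].
have sub u v : a <= u -> v <= b -> u < v -> ~~ (u < x < v) ->
    (forall j, h j u <= L) -> forall j t, u <= t <= v -> h j t <= L.
  move=> au vb uv xuv hu.
  have sub t : u < t < v -> a < t < b.
    case/andP=> ut tv.
    by rewrite (le_lt_trans au ut) (lt_le_trans tv vb).
  have nx t : u < t < v -> t \notin s -> t \notin x :: s.
    move=> tuv ts; rewrite inE negb_or ts andbT.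
    by apply: contraNneq xuv => <-.
  apply: IH => //.
  - move=> j; apply: continuous_subspaceW (hc j) => t /=.
    by rewrite !in_itv/= => /andP[? ?]; apply/andP; split;
      [exact: le_trans au _|exact: le_trans vb].
  - by move=> j t tuv ts; apply: hd; [exact: sub|exact: nx].
  - by move=> j t tuv ts; apply: hmax; [exact: sub|exact: nx].
have [/andP[ax xb]|nxab] := boolP (a < x < b); last exact: sub.
have hx : forall j t, a <= t <= x -> h j t <= L.
  by apply: sub; rewrite ?ltxx ?andbF// ltW.
move=> j t /andP[at_ tb]; have [tx|xt] := leP t x; first by apply: hx; rewrite at_.
apply: (sub x b); rewrite ?ltxx// ?(ltW ax)//; last by rewrite (ltW xt).
by move=> i; apply: hx; rewrite lexx (ltW ax).
Qed.

End RealAnalysis.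

(** * Positivity, pressure ratios, and scaling and monotonicity of the flux *)

Section Flux.
Context {R : realType} {Vs Vd E : finType}.
Variables (N : network R Vs Vd E) (M : mixture R Vs Vd).
Hypotheses (hN : valid_network N) (hM : valid_mixture M).

(** A single mass fraction may be zero, but if the nonnegative terms summed to zero all fractions
    would vanish, against their total of 1. *)
Lemma mixture_sum_gt0 (s x : 'I_2 -> R) :
  (forall m, 0 < s m) -> concentration x -> 0 < \sum_(m < 2) s m ^+ 2 * x m.
Proof.
move=> s0 [x01 x1].
have xge m : 0 <= x m by case/andP: (x01 m).
rewrite lt0r sumr_ge0 => [|m _]; last by rewrite mulr_ge0 ?sqr_ge0.
rewrite andbT; apply/eqP => /eqP; rewrite psumr_eq0 => [/allP s0x|m _]; last first.
  by rewrite mulr_ge0 ?sqr_ge0.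
suff : \sum_(m < 2) x m = 0 by rewrite x1 => /eqP; rewrite oner_eq0.
rewrite big1 // => m _; have := s0x m; rewrite mem_index_enum => /(_ isT).
by rewrite implyTb mulf_eq0 expf_eq0/= (gt_eqF (s0 m)) => /eqP.
Qed.

Lemma c_sq_gt0 j : 0 < c_sq M j.
Proof. by case: hM => s0 _ _ ?; exact: mixture_sum_gt0. Qed.

Lemma b_sq_gt0 j : 0 < b_sq M j.
Proof. by case: hM => s0 _ ? _; exact: mixture_sum_gt0. Qed.

Lemma theta_sq_gt0 v : 0 < theta_sq M v.
Proof.
by case: hM => s0 ? _ _; case: v => [i|j]; [exact: mixture_sum_gt0|exact: c_sq_gt0].
Qed.

Lemma chi_gt0 k : 0 < chi N k.
Proof.
case: hN => _ _ /(_ k)[_ d0 _].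
by rewrite /chi divr_gt0 ?mulr_gt0 ?pi_gt0 ?exprn_gt0.
Qed.

Lemma inertia_gt0 (mo : E -> R) j : (forall k, 1 <= mo k) -> 0 < inertia N mo j.
Proof.
move=> mo1; case: hN => _ /(_ j)[k0 kj] pos.
have t0 k : 0 < chi N k * len N k * mo k.
  have [l0 _ _] := pos k.
  by rewrite mulr_gt0 ?(lt_le_trans ltr01 (mo1 k))// mulr_gt0 ?chi_gt0.
rewrite /inertia (bigD1 k0) ?kj//= ltr_pwDl // sumr_ge0 // => k _.
exact: ltW.
Qed.

Implicit Types (mi mo : E -> R) (ps : Vs -> R) (p q : Vd -> R).

(** This is the equation of state: the pressure is the sum of the partial pressures, and [a_sq] or
    [c_sq] in [partial_density] is the matching normalisation. *)
Lemma node_pressure_mixture ps p v :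
  \sum_(m < 2) sigma M m ^+ 2 * partial_density M ps p v m = node_pressure ps p v.
Proof.
have dist (x : 'I_2 -> R) (y : R) : 0 < \sum_(m < 2) sigma M m ^+ 2 * x m ->
    \sum_(m < 2) sigma M m ^+ 2
      * (x m * y / \sum_(m < 2) sigma M m ^+ 2 * x m) = y.
  move=> x0; under eq_bigr => m _ do rewrite !mulrA.
  by rewrite -!mulr_suml mulrAC divff ?mul1r ?gt_eqF.
by case: v => [i|j] /=; apply: dist; [exact: (theta_sq_gt0 (inl i))|exact: c_sq_gt0].
Qed.

Lemma density_ratio_pressure (eps : R) mi mo ps p : eps <= 1 ->
  (forall k, 1 <= mi k) -> (forall k, 1 <= mo k) ->
  (forall v, 0 < node_pressure ps p v) ->
  density_ratio_condition N M eps mi mo ps p ->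
  forall k, mi k * node_pressure ps p (src N k) <= 2 * (mo k * p (dst N k)).
Proof.
move=> eps1 mi1 mo1 p0 ratio k.
have pd0 v m : 0 <= partial_density M ps p v m.
  case: hM => _ al _ et; case: v (p0 v) => [i|j] /= v0.
    by rewrite divr_ge0 ?(ltW (theta_sq_gt0 (inl i)))// mulr_ge0 ?(ltW v0)//;
      case: (al i) => /(_ m)/andP[].
  by rewrite divr_ge0 ?(ltW (c_sq_gt0 j))// mulr_ge0 ?(ltW v0)//;
    case: (et j) => /(_ m)/andP[].
have part m : mi k * partial_density M ps p (src N k) m
    <= 2 * (mo k * partial_density M ps p (inr (dst N k)) m).
  have [] := ratio k m; rewrite /inlet_density /outlet_density.
  have := pd0 (src N k) m; have := pd0 (inr (dst N k)) m.
  set x := partial_density _ _ _ (inr _) _.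
  set y := partial_density _ _ _ (src _ _) _ => x0 y0 r1 r2.
  have X0 : 0 <= mo k * x by rewrite mulr_ge0 // (le_trans ler01).
  have Y0 : 0 <= mi k * y by rewrite mulr_ge0 // (le_trans ler01).
  move: X0 Y0 r1 r2; move: (mo k * x) (mi k * y) => X Y X0 Y0 r1 r2.
  have {r1 r2}[r1 r2] := (lt_le_trans r1 eps1, lt_le_trans r2 eps1).
  (* If [X = 0], the quotient by [X] is 0 and says nothing; the quotient by [Y] would be 1 for
     [Y > 0], so [Y = 0]. Otherwise [Y - X < X]. *)
  move: X0; rewrite le_eqVlt => /predU1P[X0|X0].
    move: Y0; rewrite le_eqVlt => /predU1P[<-|Y0]; first by rewrite -X0 mulr0.
    by move: r1; rewrite -X0 sub0r normrN gtr0_norm// divff ?gt_eqF// ltxx.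
  move: r2; rewrite ltr_pdivrMr // mul1r => /ltr_distlCBl.
  by move=> ?; lra.
rewrite -[p (dst N k)]/(node_pressure ps p (inr (dst N k))).
rewrite -!node_pressure_mixture.
rewrite !mulr_sumr; apply: ler_sum => m _.
rewrite mulrCA (mulrCA (mo k)) (mulrCA 2).
by rewrite ler_wpM2l ?sqr_ge0.
Qed.

Lemma fluxE mi mo ps p k :
  mo k * p (dst N k) < mi k * node_pressure ps p (src N k) ->
  0 <= mo k * p (dst N k) ->
  flux N M mi mo ps p k = Lambda N k * Num.sqrt (mo k * p (dst N k)
    * (mi k * node_pressure ps p (src N k) - mo k * p (dst N k))
    / c_sq M (dst N k)).
Proof.
rewrite /flux -subr_gt0 => d0 po0; rewrite gtr0_sg // mul1r ger0_norm.
  by rewrite mulrAC.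
by rewrite mulr_ge0 ?divr_ge0 ?(ltW d0)// ltW// c_sq_gt0.
Qed.

Lemma Lambda_ge0 k : 0 <= Lambda N k. Proof. exact: sqrtr_ge0. Qed.

Lemma flux_gt0_lt mi mo ps p k : 0 < flux N M mi mo ps p k ->
  mo k * p (dst N k) < mi k * node_pressure ps p (src N k).
Proof.
rewrite !ltNge; apply: contra; rewrite -subr_le0 /flux => d0.
rewrite mulr_le0_ge0 ?sqrtr_ge0// mulr_le0_ge0 ?Lambda_ge0//.
by rewrite sgr_le0.
Qed.

(** The product of two pressures under the root picks up [c ^+ 2], and the sign is unchanged. *)
Lemma flux_scale (c : R) mi mo ps p k : 0 < c ->
  flux N M mi mo (fun i => c * ps i) (fun j => c * p j) k
  = c * flux N M mi mo ps p k.
Proof.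
move=> c0; rewrite /flux.
have -> : node_pressure (fun i => c * ps i) (fun j => c * p j) (src N k)
    = c * node_pressure ps p (src N k) by case: (src N k).
rewrite !(mulrCA _ c) -!mulrBr sgrM gtr0_sg // mul1r.
set d := (_ - _); rewrite -(mulrA c) mulrACA normrM -expr2.
rewrite sqrtrM ?normr_ge0// (ger0_norm (sqr_ge0 c)) sqrtr_sqr (gtr0_norm c0).
by rewrite mulrCA.
Qed.

(* For a fixed inlet pressure [A], the product [x * (A - x)] decreases in the
   outlet pressure [x] on [A / 2 <= x]. *)
Lemma flux_mono mi mo ps p ps' p' k :
  1 <= mi k -> 1 <= mo k -> 0 < p' (dst N k) ->
  0 < flux N M mi mo ps p k ->
  node_pressure ps p (src N k) <= node_pressure ps' p' (src N k) ->
  p' (dst N k) <= p (dst N k) ->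
  mi k * node_pressure ps' p' (src N k) <= 2 * (mo k * p' (dst N k)) ->
  flux N M mi mo ps p k <= flux N M mi mo ps' p' k.
Proof.
move=> mi1 mo1 p'0 /flux_gt0_lt lt1 leA lex ratio.
have mi0 := lt_le_trans ltr01 mi1; have mo0 := lt_le_trans ltr01 mo1.
have {}leA : mi k * node_pressure ps p (src N k)
    <= mi k * node_pressure ps' p' (src N k) by rewrite ler_pM2l.
have {}lex : mo k * p' (dst N k) <= mo k * p (dst N k) by rewrite ler_pM2l.
have x'0 : 0 < mo k * p' (dst N k) by rewrite mulr_gt0.
have lt2 := le_lt_trans lex (lt_le_trans lt1 leA).
rewrite !fluxE ?(ltW x'0)// ?(le_trans (ltW x'0))//.
rewrite ler_wpM2l ?Lambda_ge0// ler_wsqrtr// ler_wpM2r ?invr_ge0 ?(ltW (c_sq_gt0 _))//.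
move: leA lex ratio x'0; set x := mo k * p _; set x' := mo k * p' _.
set A := mi k * node_pressure ps p _; set A' := mi k * _ => leA lex ratio x'0.
have x0 : 0 <= x by apply: le_trans lex; exact: ltW.
(* The inlet pressure is raised first, then the outlet pressure lowered; the second change is
   controlled by [A' <= 2 * x' <= x + x']. *)
apply: (@le_trans _ _ (x * (A' - x))); first by rewrite ler_wpM2l ?lerD2r.
have -> : x' * (A' - x') = x * (A' - x) + (x - x') * (x + x' - A') by ring.
by rewrite lerDl mulr_ge0 ?subr_ge0//; lra.
Qed.

(** By homogeneity the right-hand side compares the first state with the second one scaled by [c],
    which has the same pressure at [j] and dominates at every other node. *)
Lemma pressure_rhs_scale_le (c : R) mi mo ps1 ps2 q1 q2 p1 p2 j :
  1 <= c ->
  (forall k, 1 <= mi k) -> (forall k, 1 <= mo k) ->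
  (forall v, 0 < node_pressure ps1 p1 v) ->
  (forall v, 0 < node_pressure ps2 p2 v) ->
  (forall k, 0 < flux N M mi mo ps1 p1 k) ->
  (forall k, 0 < flux N M mi mo ps2 p2 k) ->
  (forall k, mi k * node_pressure ps1 p1 (src N k) <= 2 * (mo k * p1 (dst N k))) ->
  (forall k, mi k * node_pressure ps2 p2 (src N k) <= 2 * (mo k * p2 (dst N k))) ->
  0 <= q2 j -> q1 j <= q2 j ->
  (forall v, node_pressure ps1 p1 v <= c * node_pressure ps2 p2 v) ->
  p1 j = c * p2 j ->
  pressure_rhs N M mi mo ps1 q1 p1 j <= c * pressure_rhs N M mi mo ps2 q2 p2 j.
Proof.
move=> c1 mi1 mo1 pos1 pos2 f1 f2 r1 r2 q20 q12 le_p eq_j.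
have c0 := lt_le_trans ltr01 c1.
have npE v : node_pressure (fun i => c * ps2 i) (fun j => c * p2 j) v
    = c * node_pressure ps2 p2 v by case: v.
rewrite /pressure_rhs mulrDr mulrBr !mulr_sumr.
apply: lerD; first apply: lerB.
(* Incoming edges: equal outlet pressures, larger inlet pressure in the scaled state, hence more
   inflow there. *)
- apply: ler_sum => k /eqP kj; rewrite [leRHS]mulrCA ler_pM2l; last first.
    by rewrite mulr_gt0 ?theta_sq_gt0 ?chi_gt0.
  rewrite -flux_scale //; apply: flux_mono => //.
  + by rewrite mulr_gt0 //; exact: (pos2 (inr _)).
  + by rewrite npE.
  + by rewrite kj eq_j.
  + by rewrite npE !(mulrCA _ c) ler_pM2l.
(* Outgoing edges: equal inlet pressures, larger outlet pressure in the scaled state, hence less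
   outflow there. The ratio bound is now that of the first state. *)
- apply: ler_sum => k /eqP kj; rewrite [leLHS]mulrCA ler_pM2l; last first.
    by rewrite mulr_gt0 ?c_sq_gt0 ?chi_gt0.
  rewrite -flux_scale //; apply: flux_mono => //.
  + exact: (pos1 (inr _)).
  + by rewrite flux_scale// mulr_gt0.
  + by rewrite npE kj /= eq_j.
  + exact: (le_p (inr _)).
- rewrite mulrCA ler_pM2l ?b_sq_gt0// (le_trans q12)//.
  by rewrite ler_peMl.
Qed.

End Flux.

(** * Comparison of the two solutions *)

Theorem proposition1 (R : realType) (Vs Vd E : finType)
  (N : network R Vs Vd E) (M : mixture R Vs Vd) (T : R)
  (mi mo : R -> E -> R)
  (ps1 ps2 : R -> Vs -> R) (q1 q2 : R -> Vd -> R)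
  (pi1 pi2 : Vd -> R) (p1 p2 : R -> Vd -> R) (eps : R)
  (hN : valid_network N) (hM : valid_mixture M) (hT : 0 < T)
  (hmi : admissible_control T mi) (hmo : admissible_control T mo)
  (hq1 : admissible_injection T q1) (hq2 : admissible_injection T q2)
  (sol1 : pressure_solution N M T mi mo ps1 q1 pi1 p1)
  (sol2 : pressure_solution N M T mi mo ps2 q2 pi2 p2)
  (flow1 : positive_flow N M T mi mo ps1 p1)
  (flow2 : positive_flow N M T mi mo ps2 p2)
  (pos1 : positive_pressure T ps1 p1) (pos2 : positive_pressure T ps2 p2)
  (heps : eps <= 1)
  (ratio1 : density_ratio_on N M T eps mi mo ps1 p1)
  (ratio2 : density_ratio_on N M T eps mi mo ps2 p2)
  (le_init : forall j, pi1 j <= pi2 j)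
  (le_slack : forall t : R, 0 <= t <= T -> forall i, ps1 t i <= ps2 t i)
  (ge_flow : forall t : R, 0 <= t <= T ->
     forall j, flow_vector q1 t j >= flow_vector q2 t j) :
  (forall t : R, 0 <= t <= T -> forall j, p1 t j <= p2 t j) /\
  (forall t : R, 0 <= t <= T ->
     forall j, total_density M (p1 t) j <= total_density M (p2 t) j).
Proof.
have c0 := c_sq_gt0 hM.
suff le_p : forall t : R, 0 <= t <= T -> forall j, p1 t j <= p2 t j.
  split=> // t tT j; rewrite /total_density ler_pM2r ?invr_gt0//.
  exact: le_p.
case: sol1 sol2 => init1 cont1 [s1 ode1] [init2 cont2 [s2 ode2]].
have p2_gt0 t : 0 <= t <= T -> forall j, 0 < p2 t j.
  by move=> tT j; exact: (pos2 t tT (inr j)).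
have closedT t : 0 < t < T -> 0 <= t <= T by case/andP=> *; rewrite !ltW.
pose h j t := p1 t j / p2 t j.
have Dh j t : 0 < t < T -> t \notin s1 ++ s2 ->
    is_derive t 1 (h j) (p1 t j * (- p2 t j ^- 2 * derive1 (fun s => p2 s j) t)
                         + (p2 t j)^-1 * derive1 (fun s => p1 s j) t).
  move=> tT; rewrite mem_cat negb_or => /andP[ts1 ts2].
  have [d1 _] := ode1 t tT ts1 j; have [d2 _] := ode2 t tT ts2 j.
  have D1 : is_derive t 1 (fun s => p1 s j) (derive1 (fun s => p1 s j) t).
    by rewrite derive1E; exact: DeriveDef.
  have D2 : is_derive t 1 (fun s => p2 s j) (derive1 (fun s => p2 s j) t).
    by rewrite derive1E; exact: DeriveDef.
  apply: (@is_deriveM _ _ (fun s => p1 s j) (fun s => (p2 s j)^-1)) => //.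
  by apply: is_deriveV => //; rewrite gt_eqF ?p2_gt0 ?closedT.
have hle : forall j t, 0 <= t <= T -> h j t <= 1.
  apply: (@max_le_of_derive1_le0_except _ _ _ _ (s1 ++ s2)) => //.
  - move=> j; apply/subspace_continuousP => t tT.
    have /subspace_continuousP/(_ t tT) cont1t := cont1 j.
    have /subspace_continuousP/(_ t tT) cont2t := cont2 j.
    apply: cvgM; first exact: cont1t.
    by apply: cvgV; [rewrite gt_eqF ?p2_gt0//; move: tT; rewrite /= in_itv|].
  - by move=> j t tT ts; have [] := Dh j t tT ts.
  - move=> j t tT ts h1 hmax.
    have [_] := Dh j t tT ts; rewrite -derive1E => ->.
    move: ts; rewrite mem_cat negb_or => /andP[ts1 ts2].
    have tT' := closedT t tT.
    have [_ e1] := ode1 t tT ts1 j; have [_ e2] := ode2 t tT ts2 j.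
    have mi1 k : 1 <= mi t k by have [_] := hmi k; exact.
    have mo1 k : 1 <= mo t k by have [_] := hmo k; exact.
    have r0 := inertia_gt0 hN j mo1.
    have p2j := p2_gt0 t tT' j.
    have pE : p1 t j = h j t * p2 t j by rewrite /h divfK ?gt_eqF.
    (* The scale factor is the largest ratio [h j t] at this time, so the scaled second solution
       touches the first at [j]. *)
    have le_rhs : pressure_rhs N M (mi t) (mo t) (ps1 t) (q1 t) (p1 t) j
        <= h j t * pressure_rhs N M (mi t) (mo t) (ps2 t) (q2 t) (p2 t) j.
      apply: pressure_rhs_scale_le => //.
      + exact: ltW.
      + exact: pos1.
      + exact: pos2.
      + exact: flow1.
      + exact: flow2.
      + apply: (density_ratio_pressure hM heps) => //; [exact: pos1|exact: ratio1].
      + apply: (density_ratio_pressure hM heps) => //; [exact: pos2|exact: ratio2].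
      + by have [_] := hq2 j; exact.
      (* The order is assumed for the withdrawals [- q]; for the inflows it reads [q1 <= q2]. *)
      + by have := ge_flow t tT' j; rewrite /flow_vector lerN2.
      + case=> [i|i] /=.
          apply: (le_trans (le_slack t tT' i)); rewrite ler_peMl ?ltW//.
          exact: (pos2 t tT' (inl i)).
        by rewrite -ler_pdivrMr ?p2_gt0//; exact: hmax.
    move: le_rhs; rewrite -e1 -e2 mulrCA ler_pM2l // => le_d.
    (* Multiplied by [p2 t j], the derivative of the ratio is the derivative of [p1] minus [h j t]
       times that of [p2], which [le_d] bounds. *)
    rewrite -(pmulr_rle0 _ p2j) mulrDr mulVKf ?gt_eqF// {1}pE.
    have -> : p2 t j * (h j t * p2 t j * (- p2 t j ^- 2
        * derive1 (fun s => p2 s j) t)) = - (h j t * derive1 (fun s => p2 s j) t).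
      by field; rewrite gt_eqF.
    by rewrite addrC subr_le0.
  - move=> j; rewrite /h init1 init2 ler_pdivrMr ?mul1r//.
    by rewrite -init2 p2_gt0// lexx ltW.
by move=> t tT j; rewrite -[leRHS]mul1r -ler_pdivrMr ?p2_gt0//; exact: hle.
Qed.
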